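(* Let $R\subset\{x\in\mathbb{R}^n\mid x\ge\mathbf{0}\}$ be a non-empty up-monotone polyhedron with $V(R)\subset\{0,1\}^n$, and let $P=R\cap[0,1]^n$. Then $$V(P)=\{\varphi(I,\zeta)\mid I\subseteq\{1,\dots,n\},\ \zeta\in V(R)\}.$$
   Context: $V(S)$ denotes the set of vertices of a polyhedron $S$. Vector inequalities are component-wise. A polyhedron $R$ is up-monotone if $x\in R$ and $y\ge x$ imply $y\in R$. For $I\subseteq\{1,\dots,n\}$ and $x\in\mathbb{R}^n$, the vector $\varphi(I,x)\in\mathbb{R}^n$ is defined component-wise by $\varphi(I,x)_i=1$ if $i\in I$ and $\varphi(I,x)_i=x_i$ otherwise. *)

(* Defs.v *)
From HB Require Import structures.
From mathcomp Require Import all_boot all_order all_algebra.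
From mathcomp Require Import boolp classical_sets reals.

Set Implicit Arguments.
Unset Strict Implicit.
Unset Printing Implicit Defensive.

Import Order.TTheory GRing.Theory Num.Theory.
Local Open Scope classical_set_scope.
Local Open Scope ring_scope.

Definition vec_le (K : realType) (n : nat) (x y : 'cV[K]_n) : Prop :=
  forall i, x i ord0 <= y i ord0.

Definition polyhedron (K : realType) (n : nat) (S : set 'cV[K]_n) : Prop :=
  exists (m : nat) (A : 'M[K]_(m, n)) (b : 'cV[K]_m),
    S = [set x | vec_le b (A *m x)].

Definition dot (K : realType) (n : nat) (c x : 'cV[K]_n) : K :=
  \sum_(i < n) c i ord0 * x i ord0.

(* [c = 0] and [d = 0] make [S] a face of itself. *)
Definition face (K : realType) (n : nat) (S F : set 'cV[K]_n) : Prop :=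
  exists (c : 'cV[K]_n) (d : K),
    (forall x, S x -> d <= dot c x) /\ F = S `&` [set x | dot c x = d].

(* The vertices of [S] are its zero-dimensional faces, that is, the points
   [v] such that the singleton of [v] is a face. *)
Definition vertices (K : realType) (n : nat) (S : set 'cV[K]_n) :
    set 'cV[K]_n :=
  [set v | face S [set v]].

Definition up_monotone (K : realType) (n : nat) (S : set 'cV[K]_n) : Prop :=
  forall x y, S x -> vec_le x y -> S y.

Definition nonneg_orthant (K : realType) (n : nat) : set 'cV[K]_n :=
  [set x | vec_le 0 x].

Definition unit_cube (K : realType) (n : nat) : set 'cV[K]_n :=
  [set x | forall i, 0 <= x i ord0 <= 1].

Definition binary_points (K : realType) (n : nat) : set 'cV[K]_n :=
  [set x | forall i, x i ord0 = 0 \/ x i ord0 = 1].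

Definition phi (K : realType) (n : nat) (I : {set 'I_n}) (x : 'cV[K]_n) :
    'cV[K]_n :=
  \col_(i < n) (if i \in I then 1 else x i ord0).

Arguments nonneg_orthant : clear implicits.
Arguments unit_cube : clear implicits.
Arguments binary_points : clear implicits.

(* Main.v *)
Require Import Defs.
From mathcomp Require Import all_boot all_order all_algebra.
From mathcomp Require Import boolp classical_sets reals.
From mathcomp Require Import lra.

(** Binary points of [P] are vertices of the cube, hence of [P]. Conversely, let
[v] be the unique minimizer of [c] over [P] and let [I] be the set of indices
where [c] is negative. Replacing the negative entries of [c] by zero gives a
nonnegative cost, and some vertex [zeta] of [R] costs at most as much as [v].
As [zeta] is binary, [phi I zeta] lies in [P]; its [c]-cost is at most that of
[phi I v], hence at most that of [v], so [phi I zeta = v] by uniqueness. *)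

Import Order.TTheory GRing.Theory Num.Theory.
Local Open Scope classical_set_scope.
Local Open Scope ring_scope.

Lemma dotDZr (K : realType) (n : nat) (c x d : 'cV[K]_n) (t : K) :
  dot c (x + t *: d) = dot c x + t * dot c d.
Proof.
rewrite /dot mulr_sumr -big_split; apply: eq_bigr => i _ /=.
by rewrite !mxE; lra.
Qed.

Lemma dotNr (K : realType) (n : nat) (c x : 'cV[K]_n) :
  dot c (- x) = - dot c x.
Proof. by rewrite /dot -sumrN; apply: eq_bigr => i _; rewrite mxE mulrN. Qed.

(** The bound [d] of a face [[set v]] can only be [dot c v], which leaves a unique minimizer. *)
Lemma verticesP (K : realType) (n : nat) (S : set 'cV[K]_n) (v : 'cV[K]_n) :
  vertices S v <-> S v /\ exists c : 'cV[K]_n, forall x, S x ->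
    dot c v <= dot c x /\ (dot c x = dot c v -> x = v).
Proof.
split=> [[c [d [dle vE]]]|[Sv [c cP]]].
  have [Sv vd] : (S `&` [set x | dot c x = d]) v by rewrite -vE.
  split=> //; exists c => x Sx; rewrite vd; split; first exact: dle.
  move=> xd; have : (S `&` [set x | dot c x = d]) x by [].
  by rewrite -vE.
exists c, (dot c v); split=> [x /cP[]//|].
by apply/seteqP; split=> [x -> //|x [/cP[_ xv] /xv]].
Qed.

(* The sum of the tight rows is minimized exactly where all of them are tight. *)
Lemma exposed_tight (K : realType) (m n : nat) (A : 'M[K]_(m, n))
    (b : 'cV[K]_m) (x : 'cV[K]_n) :
  vec_le b (A *m x) ->
  (forall d : 'cV[K]_n,
    (forall i, (A *m x) i ord0 = b i ord0 -> (A *m d) i ord0 = 0) -> d = 0) ->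
  vertices [set y | vec_le b (A *m y)] x.
Proof.
move=> bx inj; apply/verticesP; split=> //.
pose T := [set i | (A *m x) i ord0 == b i ord0]%SET.
exists (\col_j \sum_(i in T) A i j).
have dotE y : dot (\col_j \sum_(i in T) A i j) y =
    \sum_(i in T) (A *m y) i ord0.
  rewrite /dot; under eq_bigr => j _ do rewrite mxE mulr_suml.
  by rewrite exchange_big; apply: eq_bigr => i _; rewrite mxE.
move=> y by_; rewrite !dotE.
have xy i : i \in T -> (A *m x) i ord0 <= (A *m y) i ord0.
  by rewrite inE => /eqP ->; exact: by_.
split=> [|sE]; first exact: ler_sum.
(* Equal sums of termwise ordered values agree termwise, so [y - x] is annihilated by every tight
   row. *)
apply/eqP; rewrite -subr_eq0; apply/eqP/inj => i /eqP iT.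
move/eqP: sE; rewrite -subr_eq0 -sumrB psumr_eq0; last first.
  by move=> j jT; rewrite subr_ge0 xy.
move=> /allP/(_ i); rewrite mem_index_enum inE iT => /(_ isT)/eqP.
by rewrite mulmxBr !mxE.
Qed.

(* Moving from [x] along [d] must leave the polyhedron, since coordinate [j]
   decreases; the first constraint met on the way becomes tight. *)
Lemma exists_tighter (K : realType) (m n : nat) (A : 'M[K]_(m, n))
    (b : 'cV[K]_m) (x d : 'cV[K]_n) (j : 'I_n) :
  [set y | vec_le b (A *m y)] `<=` nonneg_orthant K n ->
  vec_le b (A *m x) ->
  (forall i, (A *m x) i ord0 = b i ord0 -> (A *m d) i ord0 = 0) ->
  d j ord0 < 0 ->
  exists t : K, [/\ 0 <= t, vec_le b (A *m (x + t *: d)) &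
    [set i | (A *m x) i ord0 == b i ord0]%SET
      \proper [set i | (A *m (x + t *: d)) i ord0 == b i ord0]%SET].
Proof.
move=> pos bx tight dj.
have AE t i : (A *m (x + t *: d)) i ord0 =
    (A *m x) i ord0 + t * (A *m d) i ord0.
  by rewrite mulmxDr -scalemxAr !mxE.
have [i0 i0P] : exists i, (A *m d) i ord0 < 0.
  apply/not_existsP => noneg.
  have x0 : 0 <= x j ord0 by have := pos x bx j; rewrite mxE.
  (* At this [t], coordinate [j] of [x + t *: d] is [-1]; with no row decreasing along [d], that
     point would still be feasible. *)
  pose t := (x j ord0 + 1) / - d j ord0.
  have t0 : 0 <= t by rewrite divr_ge0 //; lra.
  have : vec_le b (A *m (x + t *: d)).
    move=> i; rewrite AE (le_trans (bx i)) // lerDl mulr_ge0 //.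
    by rewrite leNgt; apply/negP/noneg.
  move=> /pos/(_ j); rewrite !mxE /t.
  have -> : (x j ord0 + 1) / - d j ord0 * d j ord0 = - (x j ord0 + 1).
    by rewrite invrN mulrN mulNr divfK // lt_eqF.
  by lra.
(* Ratio test: for a row decreasing along [d], [r i] is the step at which it becomes tight. *)
pose r i := ((A *m x) i ord0 - b i ord0) / - (A *m d) i ord0.
case: (@arg_minP _ K _ i0 [pred i | (A *m d) i ord0 < 0] r i0P) => i /= iP imin.
exists (r i); split.
- by rewrite divr_ge0 //; [rewrite subr_ge0; exact: bx|lra].
- move=> k; rewrite AE; have [kP|kP] := ltP ((A *m d) k ord0) 0.
    have := imin k kP; rewrite {2}/r ler_pdivlMr; last by lra.
    by lra.
  rewrite (le_trans (bx k)) // lerDl mulr_ge0 //.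
  by rewrite divr_ge0 //; [rewrite subr_ge0; exact: bx|lra].
apply/properP; split.
  apply/fintype.subsetP => k; rewrite !inE AE => /eqP kT.
  by rewrite tight // mulr0 addr0 kT.
exists i; rewrite !inE.
  rewrite AE /r invrN mulrN mulNr divfK; last by rewrite lt_eqF.
  by apply/eqP; lra.
by apply/eqP => /tight iE; rewrite iE ltxx in iP.
Qed.

(* Induction on the number of slack constraints: if [x] is not a vertex, a
   direction [d] preserving the tight constraints can be chosen with
   [dot c d <= 0] and, as [c] is nonnegative, with a negative coordinate. *)
Lemma exists_vertex_le (K : realType) (n : nat) (R : set 'cV[K]_n)
    (c x : 'cV[K]_n) :
  polyhedron R -> R `<=` nonneg_orthant K n -> vec_le 0 c -> R x ->
  exists2 z, vertices R z & dot c z <= dot c x.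
Proof.
move=> [m [A [b ->]]] pos c0.
pose T (y : 'cV[K]_n) := [set i | (A *m y) i ord0 == b i ord0]%SET.
have [k] := ubnP (m - #|T x|); elim: k x => // k IH x lek bx.
have [inj|] := pselect (forall d : 'cV[K]_n,
    (forall i, (A *m x) i ord0 = b i ord0 -> (A *m d) i ord0 = 0) -> d = 0).
  by exists x => //; exact: exposed_tight.
move=> /existsNP[d0 /not_implyP[tight0 d0N0]].
have [d [j [dj cd tight]]] : exists (d : 'cV[K]_n) (j : 'I_n),
    [/\ d j ord0 < 0, dot c d <= 0 &
    forall i, (A *m x) i ord0 = b i ord0 -> (A *m d) i ord0 = 0].
  wlog cd : d0 tight0 d0N0 / dot c d0 <= 0.
    move=> wl; have [|cd] := leP (dot c d0) 0; first exact: wl.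
    apply: (wl (- d0)); last by rewrite dotNr; lra.
    + by move=> i /tight0 iE; rewrite mulmxN mxE iE oppr0.
    + by move=> /eqP; rewrite oppr_eq0 => /eqP.
  have [[j dj]|] := pselect (exists j, d0 j ord0 < 0); first by exists d0, j.
  (* Here [d0] is nonnegative and nonzero, so [- d0] has a negative coordinate and, as [c] is
     nonnegative, does not raise the cost. *)
  move=> noneg; have d_ge0 j : 0 <= d0 j ord0.
    by rewrite leNgt; apply/negP => dj; apply: noneg; exists j.
  have [j djN0] : exists j, d0 j ord0 != 0.
    apply/not_existsP => dz; apply: d0N0; apply/matrixP => i l.
    by rewrite (ord1 l) mxE; apply/eqP/negPn/negP/dz.
  exists (- d0), j; split.
  - by rewrite mxE oppr_lt0 lt_neqAle eq_sym djN0 d_ge0.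
  - rewrite dotNr oppr_le0; apply: sumr_ge0 => i _; apply: mulr_ge0 => //.
    by have := c0 i; rewrite mxE.
  - by move=> i /tight0 iE; rewrite mulmxN mxE iE oppr0.
have [t [t0 by_ /proper_card ltT]] :=
  exists_tighter _ _ _ _ _ _ _ _ pos bx tight dj.
have [|z zv zle] := IH (x + t *: d) _ by_.
  (* Since subtraction truncates, a strict decrease needs [#|T x| < m]. *)
  have := max_card (T (x + t *: d)); rewrite card_ord => le_m.
  rewrite -ltnS (leq_trans _ lek) // ltnS ltn_sub2l //.
  exact: leq_trans ltT le_m.
exists z => //; rewrite (le_trans zle) // dotDZr gerDl.
by rewrite mulr_ge0_le0.
Qed.

Lemma binary_vertex (K : realType) (n : nat) (S : set 'cV[K]_n)
    (v : 'cV[K]_n) :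
  S `<=` unit_cube K n -> binary_points K n v -> S v -> vertices S v.
Proof.
move=> cube bin Sv; apply/verticesP; split=> //.
(* The cost is [1] where [v] is [0] and [-1] where [v] is [1], so over [[0,1]] each term is
   minimized only at the entry of [v]. *)
exists (\col_i (1 - 2 * v i ord0)) => x Sx.
have le i : (\col_i (1 - 2 * v i ord0)) i ord0 * v i ord0 <=
    (\col_i (1 - 2 * v i ord0)) i ord0 * x i ord0.
  by rewrite !mxE; have := cube x Sx i; case: (bin i) => ->; lra.
split=> [|/eqP]; first by apply: ler_sum.
rewrite -subr_eq0 -sumrB psumr_eq0; last by move=> i _; rewrite subr_ge0.
move=> /allP sE; apply/matrixP => i l; rewrite (ord1 l).
have /eqP := sE i (mem_index_enum i).
by rewrite !mxE; case: (bin i) => ->; lra.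
Qed.

(** The coordinates in [I] contribute a constant independent of [x], so comparing [c]-costs after
    [phi I] amounts to comparing costs with the entries in [I] zeroed. *)
Lemma dot_phi (K : realType) (n : nat) (I : {set 'I_n}) (c x : 'cV[K]_n) :
  dot c (phi I x) =
  dot (\col_i (if i \in I then 0 else c i ord0)) x + \sum_(i in I) c i ord0.
Proof.
rewrite /dot [X in _ + X]big_mkcond -big_split; apply: eq_bigr => i _ /=.
by rewrite !mxE; case: ifP; lra.
Qed.

Lemma phi_binary (K : realType) (n : nat) (I : {set 'I_n}) (x : 'cV[K]_n) :
  binary_points K n x -> binary_points K n (phi I x).
Proof. by move=> bin i; rewrite mxE; case: ifP => _; [right|exact: bin]. Qed.

Lemma binary_cube (K : realType) (n : nat) :
  binary_points K n `<=` unit_cube K n.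
Proof. by move=> x bin i; case: (bin i) => ->; lra. Qed.

Lemma le_phi (K : realType) (n : nat) (I : {set 'I_n}) (x : 'cV[K]_n) :
  unit_cube K n x -> vec_le x (phi I x).
Proof. by move=> cube i; rewrite mxE; have := cube i; case: ifP; lra. Qed.

Theorem corollary3p5 (K : realType) (n : nat) (R P : set 'cV[K]_n)
  (R_polyhedron : polyhedron R)
  (R_nonneg : R `<=` nonneg_orthant K n)
  (R_nonempty : R !=set0)
  (R_up : up_monotone R)
  (R_vertices : vertices R `<=` binary_points K n)
  (P_def : P = R `&` unit_cube K n) :
  vertices P = [set phi I zeta | I in [set: {set 'I_n}] & zeta in vertices R].
Proof.
have phiP I z : vertices R z -> P (phi I z).
  move=> zv; have zbin := R_vertices _ zv; rewrite P_def; split.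
    by apply: R_up (le_phi _ _ I z (binary_cube _ _ _ zbin)); case/verticesP: zv.
  exact/binary_cube/phi_binary.
apply/seteqP; split=> [v /verticesP[Pv [c cP]]|_ [I _ [z zv <-]]]; last first.
  apply: binary_vertex (phiP I z zv); first by rewrite P_def => x [].
  exact/phi_binary/R_vertices.
have [Rv cubev] : R v /\ unit_cube K n v by move: Pv; rewrite P_def.
pose I := [set i | c i ord0 < 0]%SET.
pose c' : 'cV[K]_n := \col_i (if i \in I then 0 else c i ord0).
have c'0 : vec_le 0 c' by move=> i; rewrite !mxE inE; case: ltP.
have [z zv zle] := exists_vertex_le _ _ _ _ _ R_polyhedron R_nonneg c'0 Rv.
exists I => //; exists z => //.
have [cle] := cP _ (phiP I z zv); apply.
apply/eqP; rewrite eq_le cle andbT.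
apply: (@le_trans _ _ (dot c (phi I v))); first by rewrite !dot_phi lerD2r.
(* Raising a coordinate of [v] to [1] where [c] is negative cannot increase the cost. *)
apply: ler_sum => i _; rewrite mxE inE; case: ifP => // ci.
by rewrite ler_nM2l //; have /andP[] := cubev i.
Qed.
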